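(* Let $G$ be a finite group, $\mathcal{P}$ a finite $G$-poset, and $R$ a commutative ring with identity. Assume that the transporter category $\mathcal{P}\rtimes G$ is connected, and let $\Pi_0(\mathcal{P})$ denote the number of connected components of $\mathcal{P}$. If $\Pi_0(\mathcal{P})$ is invertible in $R$, then every right $RG$-module $M$ is (isomorphic to) a direct summand of $LK_{\pi}\mathfrak{F}$ for some right $R(\mathcal{P}\rtimes G)$-module $\mathfrak{F}$. In particular, if $\mathcal{P}$ is connected, then $M\cong LK_{\pi}\kappa_M$ for every right $RG$-module $M$.
   Context: Modules are finitely generated right modules. A $G$-poset is a poset with an action of $G$ by order-preserving automorphisms, written $x\mapsto {}^g x$; it is regarded as a category with one morphism $x\to y$ whenever $x\le y$. The transporter category $\mathcal{P}\rtimes G$ has the same objects as $\mathcal{P}$; its morphisms $x\to y$ are formal products $\alpha g$ with $g\in G$ and $\alpha:{}^g x\to y$ a morphism of $\mathcal{P}$; composition is $(\alpha g)(\beta h)=(\alpha\,{}^g\beta)(gh)$. The functor $\pi:\mathcal{P}\rtimes G\to G$ (with $G$ viewed as a one-object category) sends $\alpha g$ to $g$. Right modules over the category algebra $R(\mathcal{P}\rtimes G)$ are identified with contravariant functors from $\mathcal{P}\rtimes G$ to (finitely generated) $R$-modules. The restriction $Res_{\pi}:\text{mod-}RG\to\text{mod-}R(\mathcal{P}\rtimes G)$ is precomposition with $\pi$; write $\kappa_M=Res_{\pi}M$ (the constant $G$-presheaf attached to $M$). $LK_{\pi}:\text{mod-}R(\mathcal{P}\rtimes G)\to \text{mod-}RG$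 is the left Kan extension along $\pi$, i.e. the left adjoint of $Res_\pi$; on underlying $R$-modules it is the colimit of the restriction of the presheaf to $\mathcal{P}$. A category is connected if any two of its objects are joined by a zigzag of morphisms; connected components of $\mathcal{P}$ are those of its classifying space (order complex) $B\mathcal{P}$. *)

(* Defs.v *)
From HB Require Import structures.
From Stdlib Require Import Relation_Operators.
From mathcomp Require Import all_boot all_order all_fingroup all_algebra
  generic_quotient ring_quotient boolp.

Set Implicit Arguments.
Unset Strict Implicit.
Unset Printing Implicit Defensive.

Import GRing.Theory.

Local Open Scope ring_scope.

Record category := Category {
  ob :> Type;
  hom : ob -> ob -> Type;
  idm : forall x, hom x x;
  comp : forall x y z, hom y z -> hom x y -> hom x z;
  comp1m : forall x y (f : hom x y), comp (idm y) f = f;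
  compm1 : forall x y (f : hom x y), comp f (idm x) = f;
  compA : forall x y z t (f : hom z t) (g : hom y z) (h : hom x y),
    comp f (comp g h) = comp (comp f g) h }.

Arguments hom {c} x y.
Arguments idm {c} x.
Arguments comp {c x y z} f g.

Record functor (C D : category) := Functor {
  fob :> C -> D;
  fmap : forall x y : C, hom x y -> hom (fob x) (fob y);
  fmap1 : forall x : C, fmap (idm x) = idm (fob x);
  fmapM : forall (x y z : C) (f : hom y z) (g : hom x y),
    fmap (comp f g) = comp (fmap f) (fmap g) }.

Arguments fmap {C D} _ {x y} _.

(* The equivalence closure of "there is a morphism" is the relation of being
   joined by a zigzag of morphisms. *)
Definition connected_cat (C : category) : Prop :=
  forall x y : C, clos_refl_sym_trans C (fun a b => inhabited (hom a b)) x y.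

Section PosetCat.
Variables (d : Order.disp_t) (P : finPOrderType d).

Definition poset_cat : category.
Proof.
refine (@Category P (fun x y : P => (x <= y)%O)
  (fun x => Order.le_refl x)
  (fun x y z (f : (y <= z)%O) (g : (x <= y)%O) => Order.POrderTheory.le_trans g f)
  _ _ _).
- by move=> x y f; apply: bool_irrelevance.
- by move=> x y f; apply: bool_irrelevance.
- by move=> x y z t f g h; apply: bool_irrelevance.
Defined.

(* The path components of the order complex are those of its 1-skeleton, which
   is the comparability graph of the poset. *)
Definition Pi0 : nat := n_comp (fun x y : P => (x >=< y)%O) P.

Lemma zigzag_comparable (x y : P) :
  clos_refl_sym_trans P (fun a b => inhabited ((a <= b)%O : Prop)) x y <->
  connect (fun x y : P => (x >=< y)%O) x y.
Proof.
have csym : connect_sym (fun x y : P => (x >=< y)%O).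
  by apply: sym_connect_sym => a b; rewrite Order.POrderTheory.comparable_sym.
split.
- elim=> {x y} [x y [le_xy]|x|x y _|x y z _ xy _ yz].
  + by apply: connect1; rewrite Order.POrderTheory.le_comparable.
  + exact: connect0.
  + by rewrite csym.
  + exact: connect_trans xy yz.
- case/connectP=> p; elim: p x => [|z p IH] x /=; first by move=> _ ->; apply: rst_refl.
  case/andP=> /orP xz zp yE; apply: rst_trans (IH _ zp yE).
  by case: xz => le; [apply: rst_step | apply/rst_sym/rst_step].
Qed.

Lemma Pi0_connected : (0 < #|P|)%N -> connected_cat poset_cat -> Pi0 = 1%N.
Proof.
case/card_gt0P=> x _ conn.
have csym : connect_sym (fun x y : P => (x >=< y)%O).
  by apply: sym_connect_sym => a b; rewrite Order.POrderTheory.comparable_sym.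
rewrite -(n_comp_connect csym x); apply: eq_n_comp_r => y.
by rewrite !inE; apply/esym/zigzag_comparable/conn.
Qed.

End PosetCat.

Definition group_cat (gT : finGroupType) : category :=
  @Category unit (fun _ _ => gT) (fun _ => 1%g) (fun _ _ _ g h => (g * h)%g)
    (fun _ _ => @mul1g gT) (fun _ _ => @mulg1 gT) (fun _ _ _ _ => @mulgA gT).

(* The actions of the MathComp library are right actions; here the action is a
   left one, [rho g x] being written ^g x on paper. *)
Record poset_action (gT : finGroupType) (d : Order.disp_t)
    (P : finPOrderType d) := PosetAction {
  pact :> gT -> P -> P;
  pact1 : forall x, pact 1%g x = x;
  pactM : forall g h x, pact (g * h)%g x = pact g (pact h x);
  pact_mono : forall g, {mono pact g : x y / (x <= y)%O} }.

Section Transporter.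
Variables (gT : finGroupType) (d : Order.disp_t) (P : finPOrderType d).
Variable rho : poset_action gT P.

(* As [P] is a poset, a formal product (alpha g) with alpha : ^g x -> y is an
   element g of the group such that ^g x <= y. *)
Definition tr_hom (x y : P) : Type := {g : gT | (rho g x <= y)%O}.

Lemma tr_idm_subproof x : (rho 1%g x <= x)%O.
Proof. by rewrite pact1. Qed.

Lemma tr_comp_subproof x y z (f : tr_hom y z) (g : tr_hom x y) :
  (rho (sval f * sval g)%g x <= z)%O.
Proof.
rewrite pactM; apply: Order.POrderTheory.le_trans (valP f).
by rewrite pact_mono; apply: (valP g).
Qed.

Definition transporter : category.
Proof.
refine (@Category P tr_hom (fun x => exist _ 1%g (tr_idm_subproof x))
  (fun x y z f g => exist _ (sval f * sval g)%g (tr_comp_subproof f g)) _ _ _).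
- by move=> x y f; apply: val_inj; rewrite /= mul1g.
- by move=> x y f; apply: val_inj; rewrite /= mulg1.
- by move=> x y z t f g h; apply: val_inj; rewrite /= mulgA.
Defined.

Definition tr_pi : functor transporter (group_cat gT) :=
  @Functor transporter (group_cat gT) (fun _ => tt)
    (fun x y (f : tr_hom x y) => sval f)
    (fun _ => erefl) (fun _ _ _ _ _ => erefl).

Lemma tr_incl_subproof x y : (x <= y)%O -> (rho 1%g x <= y)%O.
Proof. by rewrite pact1. Qed.

Definition tr_incl : functor (poset_cat P) transporter.
Proof.
refine (@Functor (poset_cat P) transporter id
  (fun x y f => exist _ 1%g (tr_incl_subproof f)) _ _).
- by move=> x; apply: val_inj.
- by move=> x y z f g; apply: val_inj; rewrite /= mulg1.
Defined.

(* The morphism [1 g : ^(g^-1) x -> x]. *)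
Lemma tr_act_subproof g x : (rho g (rho g^-1%g x) <= x)%O.
Proof. by rewrite -pactM mulgV pact1. Qed.

Definition tr_act g x : @hom transporter (rho g^-1%g x) x :=
  exist _ g (tr_act_subproof g x).

End Transporter.

Definition in_span (R : pzRingType) (V : lmodType R) (s : seq V) (v : V) : Prop :=
  exists c : nat -> R, v = \sum_(i < size s) c i *: s`_i.

Definition fin_gen (R : pzRingType) (V : lmodType R) : Prop :=
  exists s : seq V, forall v, in_span s v.

Section Span.
Variables (R : pzRingType).

Lemma in_span0 (V : lmodType R) (s : seq V) : in_span s 0.
Proof. by exists (fun=> 0); rewrite big1 // => i _; rewrite scale0r. Qed.

Lemma in_spanD (V : lmodType R) (s : seq V) u v :
  in_span s u -> in_span s v -> in_span s (u + v).
Proof.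
move=> [a ->] [b ->]; exists (fun i => a i + b i); rewrite -big_split /=.
by apply: eq_bigr => i _; rewrite scalerDl.
Qed.

Lemma in_spanZ (V : lmodType R) (s : seq V) a v : in_span s v -> in_span s (a *: v).
Proof.
move=> [b ->]; exists (fun i => a * b i); rewrite scaler_sumr.
by apply: eq_bigr => i _; rewrite scalerA.
Qed.

Lemma in_span_sum (V : lmodType R) (s : seq V) (I : Type) (r : seq I) (F : I -> V) :
  (forall i, in_span s (F i)) -> in_span s (\sum_(i <- r) F i).
Proof.
by move=> sF; elim/big_rec: _ => [|i v _ sv]; [exact: in_span0 | exact: in_spanD].
Qed.

Lemma in_span_mem (V : lmodType R) (s : seq V) v : v \in s -> in_span s v.
Proof.
move=> sv; have lt_i : (index v s < size s)%N by rewrite index_mem.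
exists (fun i => (i == index v s)%:R).
rewrite (bigD1 (Ordinal lt_i)) //= eqxx scale1r nth_index // big1 ?addr0 // => i.
by rewrite -val_eqE /= => /negPf ->; rewrite scale0r.
Qed.

Lemma in_span_sub (V W : lmodType R) (f : {linear V -> W}) (s : seq V) (t : seq W) v :
  in_span s v -> {in s, forall u, f u \in t} -> in_span t (f v).
Proof.
move=> [c ->] st; rewrite linear_sum; apply: in_span_sum => i.
by rewrite linearZ; apply/in_spanZ/in_span_mem/st/mem_nth.
Qed.

End Span.

(* For a finite category C the contravariant functors from C to finitely generated
   R-modules are the finitely generated right modules over
   the category algebra RC.  In particular a presheaf M on [group_cat gT] is a
   finitely generated right RG-module, with v . g := psh_map M g v. *)

Record presheaf (R : comPzRingType) (C : category) := Presheaf {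
  psh_ob :> C -> lmodType R;
  psh_map : forall x y : C, hom x y -> {linear psh_ob y -> psh_ob x};
  psh_map1 : forall (x : C) (v : psh_ob x), psh_map (idm x) v = v;
  psh_mapM : forall (x y z : C) (f : hom y z) (g : hom x y) (v : psh_ob z),
    psh_map (comp f g) v = psh_map g (psh_map f v);
  psh_fg : forall x : C, fin_gen (psh_ob x) }.

Arguments psh_map {R C} _ {x y} _.

Section Presheaves.
Variables (R : comPzRingType).

Record psh_hom (C : category) (F H : presheaf R C) := PshHom {
  phom :> forall x : C, {linear F x -> H x};
  phom_nat : forall (x y : C) (f : hom x y) (v : F y),
    phom x (psh_map F f v) = psh_map H f (phom y v) }.

Definition psh_iso (C : category) (F H : presheaf R C) : Prop :=
  exists (a : psh_hom F H) (b : psh_hom H F),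
    forall x : C, cancel (a x) (b x) /\ cancel (b x) (a x).

Definition psh_precomp (C D : category) (u : functor C D) (F : presheaf R D) :
    presheaf R C :=
  @Presheaf R C (fun x => F (u x)) (fun x y f => psh_map F (fmap u f))
    (fun x v => etrans (congr1 (fun g => psh_map F g v) (fmap1 u x))
                       (psh_map1 v))
    (fun x y z f g v => etrans (congr1 (fun h => psh_map F h v) (fmapM u f g))
                               (psh_mapM _ _ v))
    (fun x => psh_fg F (u x)).

Section DirectSum.
Variables (C : category) (F H : presheaf R C).

Definition psh_sum_map (x y : C) (f : hom x y) (v : (F y * H y)%type) :
    (F x * H x)%type := (psh_map F f v.1, psh_map H f v.2).

Lemma psh_sum_map_linear x y (f : hom x y) : linear (psh_sum_map f).
Proof. by move=> a u v; rewrite /psh_sum_map /= !linearP. Qed.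

HB.instance Definition _ x y (f : hom x y) :=
  GRing.isLinear.Build R (F y * H y)%type (F x * H x)%type *:%R
    (psh_sum_map f) (psh_sum_map_linear f).

Lemma psh_sum_fg (x : C) : fin_gen ((F x * H x)%type : lmodType R).
Proof.
have [s sF] := psh_fg F x; have [t tH] := psh_fg H x.
pose i1 (u : F x) : F x * H x := (u, 0); pose i2 (u : H x) : F x * H x := (0, u).
have l1 : linear i1.
  by move=> a u v; rewrite /i1; congr pair; rewrite /= scaler0 addr0.
have l2 : linear i2.
  by move=> a u v; rewrite /i2; congr pair; rewrite /= scaler0 addr0.
pose j1 := GRing.isLinear.Build R _ _ *:%R i1 l1.
pose j2 := GRing.isLinear.Build R _ _ *:%R i2 l2.
pose f1 : {linear F x -> (F x * H x)%type} := HB.pack i1 j1.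
pose f2 : {linear H x -> (F x * H x)%type} := HB.pack i2 j2.
exists (map f1 s ++ map f2 t) => -[u v].
have -> : (u, v) = f1 u + f2 v by congr pair; rewrite /= ?addr0 ?add0r.
apply: in_spanD; [apply: in_span_sub (sF u) _ | apply: in_span_sub (tH v) _].
  by move=> w sw; rewrite mem_cat map_f.
by move=> w sw; rewrite mem_cat orbC map_f.
Qed.

Definition psh_sum : presheaf R C.
Proof.
refine (@Presheaf R C (fun x => (F x * H x)%type : lmodType R)
  (fun x y f => psh_sum_map f : {linear _ -> _}) _ _ psh_sum_fg).
- by move=> x [u v]; rewrite /= /psh_sum_map /= !psh_map1.
- by move=> x y z f g [u v]; rewrite /= /psh_sum_map /= !psh_mapM.
Defined.

End DirectSum.

Definition direct_summand (C : category) (F H : presheaf R C) : Prop :=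
  exists F' : presheaf R C, psh_iso H (psh_sum F F').

End Presheaves.

Section Colimit.
Variables (R : comPzRingType) (d : Order.disp_t) (P : finPOrderType d).
Variable F : presheaf R (poset_cat P).

Definition psh_bigsum : Type := {dffun forall x : P, F x}.

HB.instance Definition _ := Choice.on psh_bigsum.

Definition bs_zero : psh_bigsum := [ffun x : P => 0 : F x].
Definition bs_add (u v : psh_bigsum) : psh_bigsum :=
  [ffun x : P => (u x + v x : F x)].
Definition bs_opp (u : psh_bigsum) : psh_bigsum := [ffun x : P => (- u x : F x)].
Definition bs_scale (a : R) (u : psh_bigsum) : psh_bigsum :=
  [ffun x : P => (a *: u x : F x)].

Fact bs_addA : associative bs_add.
Proof. by move=> u v w; apply/ffunP=> x; rewrite !ffunE addrA. Qed.
Fact bs_addC : commutative bs_add.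
Proof. by move=> u v; apply/ffunP=> x; rewrite !ffunE addrC. Qed.
Fact bs_add0 : left_id bs_zero bs_add.
Proof. by move=> u; apply/ffunP=> x; rewrite !ffunE add0r. Qed.
Fact bs_addN : left_inverse bs_zero bs_opp bs_add.
Proof. by move=> u; apply/ffunP=> x; rewrite !ffunE addNr. Qed.

HB.instance Definition _ :=
  GRing.isZmodule.Build psh_bigsum bs_addA bs_addC bs_add0 bs_addN.

Fact bs_scaleA a b v : bs_scale a (bs_scale b v) = bs_scale (a * b) v.
Proof. by apply/ffunP=> x; rewrite !ffunE scalerA. Qed.
Fact bs_scale1 : left_id 1 bs_scale.
Proof. by move=> u; apply/ffunP=> x; rewrite !ffunE scale1r. Qed.
Fact bs_scaleDr : right_distributive bs_scale +%R.
Proof. by move=> a u v; apply/ffunP=> x; rewrite !ffunE scalerDr. Qed.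
Fact bs_scaleDl v : {morph bs_scale^~ v: a b / a + b}.
Proof. by move=> a b; apply/ffunP=> x; rewrite !ffunE scalerDl. Qed.

HB.instance Definition _ :=
  GRing.Zmodule_isLmodule.Build R psh_bigsum bs_scaleA bs_scale1 bs_scaleDr bs_scaleDl.

Definition bs_inj (x : P) (v : F x) : psh_bigsum :=
  [ffun y : P => dfwith (fun z => 0 : F z) v y].

Lemma bs_inj_linear x : linear (@bs_inj x).
Proof.
move=> a u v; apply/ffunP=> y; rewrite !ffunE.
have [->|yx] := eqVneq y x; first by rewrite !dfwith_in.
by rewrite !dfwith_out ?scaler0 ?addr0 // eq_sym.
Qed.

HB.instance Definition _ x :=
  GRing.isLinear.Build R (F x) psh_bigsum *:%R (@bs_inj x) (@bs_inj_linear x).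

Lemma bs_sumE (u : psh_bigsum) : u = \sum_(x : P) bs_inj (u x).
Proof.
have ev y (I : seq P) (G : P -> psh_bigsum) :
  (\sum_(x <- I) G x) y = \sum_(x <- I) G x y :> F y.
  by elim: I => [|i I IH]; rewrite ?big_nil ?big_cons !ffunE ?IH.
apply/ffunP=> y; rewrite ev (bigD1 y) //= ffunE dfwith_in big1 ?addr0 // => x xy.
by rewrite ffunE dfwith_out.
Qed.

(* The submodule of the direct sum spanned by the F(f)(v) - v. *)
Inductive colim_rel : psh_bigsum -> Prop :=
| Colim_rel0 : colim_rel 0
| Colim_relD u v : colim_rel u -> colim_rel v -> colim_rel (u + v)
| Colim_relZ a u : colim_rel u -> colim_rel (a *: u)
| Colim_rel_gen (x y : poset_cat P) (f : hom x y) (v : F y) :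
    colim_rel (bs_inj (psh_map F f v) - bs_inj v).

Definition colim_relb : pred psh_bigsum := fun u => `[< colim_rel u >].

Lemma colim_relb_closed : submod_closed colim_relb.
Proof.
split; first by apply/asboolP/Colim_rel0.
by move=> a u v /asboolP ru /asboolP rv; apply/asboolP/Colim_relD=> //; apply: Colim_relZ.
Qed.

HB.instance Definition _ :=
  GRing.isSubmodClosed.Build R psh_bigsum colim_relb
    (GRing.submod_closed_semi colim_relb_closed).

Definition colim : Type := Quotient.quot (GRing.ZmodClosed.clone _ colim_relb _).

HB.instance Definition _ := GRing.Zmodule.on colim.
HB.instance Definition _ := EqQuotient.on colim.

Local Open Scope quotient_scope.

Definition colim_pi (u : psh_bigsum) : colim := \pi_colim u.

Lemma colim_piP u v : colim_pi u = colim_pi v <-> colim_rel (u - v).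
Proof.
rewrite /colim_pi; split=> [/eqP|ruv].
  by rewrite -Quotient.idealrBE => /asboolP.
by apply/eqP; rewrite -Quotient.idealrBE; apply/asboolP.
Qed.

Lemma colim_piD u v : colim_pi (u + v) = colim_pi u + colim_pi v.
Proof. by rewrite /colim_pi !piE. Qed.

Definition colim_scale (a : R) (u : colim) : colim := colim_pi (a *: repr u).

Lemma colim_piZ a u : colim_scale a (colim_pi u) = colim_pi (a *: u).
Proof.
apply/colim_piP; rewrite -scalerBr; apply: Colim_relZ.
by apply/colim_piP; rewrite /colim_pi reprK.
Qed.

Lemma colim_pi_surj (w : colim) : exists u, w = colim_pi u.
Proof. by exists (repr w); rewrite /colim_pi reprK. Qed.

Fact colim_scaleA a b v : colim_scale a (colim_scale b v) = colim_scale (a * b) v.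
Proof. by have [u ->] := colim_pi_surj v; rewrite !colim_piZ scalerA. Qed.
Fact colim_scale1 : left_id 1 colim_scale.
Proof. by move=> v; have [u ->] := colim_pi_surj v; rewrite !colim_piZ scale1r. Qed.
Fact colim_scaleDr : right_distributive colim_scale +%R.
Proof.
move=> a v w; have [u ->] := colim_pi_surj v; have [t ->] := colim_pi_surj w.
by rewrite -colim_piD !colim_piZ scalerDr colim_piD.
Qed.
Fact colim_scaleDl v : {morph colim_scale^~ v: a b / a + b}.
Proof.
by move=> a b; have [u ->] := colim_pi_surj v; rewrite !colim_piZ scalerDl colim_piD.
Qed.

HB.instance Definition _ :=
  GRing.Zmodule_isLmodule.Build R colim
    colim_scaleA colim_scale1 colim_scaleDr colim_scaleDl.

Lemma colim_pi_linear : linear colim_pi.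
Proof. by move=> a u v; rewrite colim_piD -colim_piZ. Qed.

HB.instance Definition _ :=
  GRing.isLinear.Build R psh_bigsum colim *:%R colim_pi colim_pi_linear.

Definition colim_in (x : P) (v : F x) : colim := colim_pi (bs_inj v).

Lemma colim_in_linear x : linear (@colim_in x).
Proof. by move=> a u v; rewrite /colim_in !linearP. Qed.

HB.instance Definition _ x :=
  GRing.isLinear.Build R (F x) colim *:%R (@colim_in x) (@colim_in_linear x).

Lemma colim_in_glue (x y : poset_cat P) (f : hom x y) (v : F y) :
  colim_in (psh_map F f v) = colim_in v.
Proof. exact/colim_piP/Colim_rel_gen. Qed.

Lemma colim_sumE (w : colim) :
  exists u : psh_bigsum, w = \sum_(x : P) colim_in (u x).
Proof.
have [u ->] := colim_pi_surj w; exists u.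
by rewrite [in LHS](bs_sumE u) linear_sum.
Qed.

Lemma colim_fg : fin_gen (colim : lmodType R).
Proof.
suff H (r : seq P) : exists s : seq colim, forall x, x \in r ->
    forall v : F x, in_span s (colim_in v).
  have [s sP] := H (enum P); exists s => w; have [u ->] := colim_sumE w.
  by apply: in_span_sum => x; apply: sP; rewrite mem_enum.
elim: r => [|y r [s sr]]; first by exists [::].
have [t tF] := psh_fg F y; exists (map (@colim_in y) t ++ s) => x.
rewrite inE; have [-> _|_ /= xr] := eqVneq x y => v.
  by apply: in_span_sub (tF v) _ => u tu; rewrite mem_cat map_f.
by apply: (in_span_sub (f := idfun)) (sr x xr v) _ => u su; rewrite mem_cat su orbT.
Qed.

Section Desc.
Variables (W : lmodType R) (phi : forall x : P, {linear F x -> W}).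
Hypothesis phi_glue : forall (x y : poset_cat P) (f : hom x y) (v : F y),
  phi x (psh_map F f v) = phi y v.

Let bs_desc (u : psh_bigsum) : W := \sum_(x : P) phi x (u x).

Let bs_desc_linear : linear bs_desc.
Proof.
move=> a u v; rewrite /bs_desc scaler_sumr -big_split /=; apply: eq_bigr => x _.
by rewrite !ffunE linearP.
Qed.

Let bs_desc_inj (x : P) (v : F x) : bs_desc (bs_inj v) = phi x v.
Proof.
rewrite /bs_desc (bigD1 x) //= ffunE dfwith_in big1 ?addr0 // => y yx.
by rewrite ffunE dfwith_out ?linear0 // eq_sym.
Qed.

Let bs_desc0 u : colim_rel u -> bs_desc u = 0.
Proof.
have B v w : bs_desc (v - w) = bs_desc v - bs_desc w.
  by rewrite -[- w]scaleN1r [v + _]addrC bs_desc_linear scaleN1r addrC.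
have Z0 : bs_desc 0 = 0 by rewrite -[X in bs_desc X](subrr 0) B subrr.
elim=> {u} [//|u v _ Du _ Dv|a u _ Du|x y f v].
- by rewrite -[u]scale1r bs_desc_linear scale1r Du Dv addr0.
- by rewrite -[_ *: u]addr0 bs_desc_linear Du Z0 scaler0 addr0.
- by rewrite B !bs_desc_inj phi_glue subrr.
Qed.

Definition colim_desc_fun (w : colim) : W :=
  \sum_(x : P) phi x ((repr w : psh_bigsum) x).

Let colim_descE u : colim_desc_fun (colim_pi u) = bs_desc u.
Proof.
have /colim_piP/bs_desc0 : colim_pi (repr (colim_pi u)) = colim_pi u.
  by rewrite /colim_pi reprK.
rewrite -[- u]scaleN1r [_ + (-1 *: u)]addrC bs_desc_linear scaleN1r addrC => /eqP.
by rewrite subr_eq0 => /eqP.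
Qed.

Lemma colim_desc_linear : linear colim_desc_fun.
Proof.
move=> a v w; have [u ->] := colim_pi_surj v; have [t ->] := colim_pi_surj w.
by rewrite -linearP !colim_descE bs_desc_linear.
Qed.

Definition colim_desc : {linear colim -> W} :=
  HB.pack colim_desc_fun
    (GRing.isLinear.Build R colim W *:%R colim_desc_fun colim_desc_linear).

Lemma colim_desc_in (x : P) (v : F x) : colim_desc (colim_in v) = phi x v.
Proof. exact: etrans (colim_descE _) (bs_desc_inj v). Qed.

End Desc.

Lemma colim_ext (W : lmodType R) (f g : {linear colim -> W}) :
  (forall (x : P) (v : F x), f (colim_in v) = g (colim_in v)) -> f =1 g.
Proof.
move=> fg w; have [u ->] := colim_sumE w; rewrite !linear_sum.
by apply: eq_bigr => x _; rewrite fg.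
Qed.

End Colimit.

Section LeftKan.
Variables (R : comPzRingType) (gT : finGroupType) (d : Order.disp_t).
Variables (P : finPOrderType d) (rho : poset_action gT P).

Definition Res_pi (M : presheaf R (group_cat gT)) : presheaf R (transporter rho) :=
  psh_precomp (tr_pi rho) M.

Section Object.
Variable F : presheaf R (transporter rho).

Definition LK_ob : Type := colim (psh_precomp (tr_incl rho) F).
HB.instance Definition _ := GRing.Lmodule.on LK_ob.

Definition LK_in (x : P) : F x -> LK_ob :=
  @colim_in R d P (psh_precomp (tr_incl rho) F) x.

Lemma LK_in_linear x : linear (@LK_in x).
Proof. exact: (@colim_in_linear R d P (psh_precomp (tr_incl rho) F) x). Qed.

HB.instance Definition _ x :=
  GRing.isLinear.Build R (F x) LK_ob *:%R (@LK_in x) (@LK_in_linear x).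

(* In the colimit over P, only the group component of a morphism matters. *)
Lemma LK_in_glue (x x' y : transporter rho) (f : hom x y) (f' : hom x' y) (v : F y) :
  sval f = sval f' -> (x <= x' :> P)%O ->
  LK_in (psh_map F f v) = LK_in (psh_map F f' v).
Proof.
move=> ff' xx'; rewrite -[RHS](colim_in_glue (F := psh_precomp (tr_incl rho) F)
  (xx' : @hom (poset_cat P) x x')) /=.
rewrite -psh_mapM; congr (LK_in (psh_map F _ v)).
by apply: val_inj; rewrite /= mulg1.
Qed.

(* The class of v in F x is sent by g to the class of v . (1 g), where
   1 g : ^(g^-1) x -> x. *)
Definition LK_act_in (g : gT) (x : P) (v : F x) : LK_ob :=
  LK_in (psh_map F (tr_act rho g x) v).

Lemma LK_act_in_linear g x : linear (@LK_act_in g x).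
Proof. by move=> a u v; rewrite /LK_act_in !linearP. Qed.

HB.instance Definition _ g x :=
  GRing.isLinear.Build R (F x) LK_ob *:%R (@LK_act_in g x) (@LK_act_in_linear g x).

Lemma LK_act_glue g (x y : poset_cat P) (f : hom x y) (v : F y) :
  LK_act_in g (psh_map F (fmap (tr_incl rho) f) v) = LK_act_in g v.
Proof.
rewrite /LK_act_in -psh_mapM; apply: LK_in_glue; first by rewrite /= mul1g.
by rewrite pact_mono.
Qed.

Definition LK_act (g : gT) : {linear LK_ob -> LK_ob} :=
  @colim_desc R d P (psh_precomp (tr_incl rho) F) LK_ob
    (fun x => @LK_act_in g x) (@LK_act_glue g).

Lemma LK_act_E g (x : P) (v : F x) :
  LK_act g (LK_in v) = LK_in (psh_map F (tr_act rho g x) v).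
Proof.
exact: (@colim_desc_in R d P (psh_precomp (tr_incl rho) F) LK_ob
  (fun x => @LK_act_in g x) (@LK_act_glue g) x v).
Qed.

Lemma LK_ext (W : lmodType R) (f g : {linear LK_ob -> W}) :
  (forall (x : P) (v : F x), f (LK_in v) = g (LK_in v)) -> f =1 g.
Proof. by move=> fg; apply: (@colim_ext R d P (psh_precomp (tr_incl rho) F) W f g fg). Qed.

Lemma LK_act1 : LK_act 1%g =1 idfun.
Proof.
apply: LK_ext => x v; rewrite LK_act_E -[in RHS](psh_map1 v).
by apply: LK_in_glue => //=; rewrite invg1 pact1.
Qed.

Lemma LK_actM g h : LK_act (g * h)%g =1 LK_act h \o LK_act g.
Proof.
apply: LK_ext => x v; rewrite [RHS](_ : _ = LK_act h (LK_act g (LK_in v))) // !LK_act_E -psh_mapM.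
by apply: LK_in_glue => //=; rewrite invMg pactM.
Qed.

Definition LK_pi : presheaf R (group_cat gT) :=
  @Presheaf R (group_cat gT) (fun _ => LK_ob : lmodType R)
    (fun _ _ g => LK_act g) (fun _ => LK_act1) (fun _ _ _ g h => LK_actM g h)
    (fun _ => colim_fg (psh_precomp (tr_incl rho) F)).

Lemma LK_unit_nat (x y : transporter rho) (f : hom x y) (v : F y) :
  LK_in (psh_map F f v) = psh_map (Res_pi LK_pi) f (LK_in v).
Proof.
rewrite [RHS]LK_act_E; apply: LK_in_glue => //=.
by rewrite -(pact_mono rho (sval f)) -pactM mulgV pact1 (valP f).
Qed.

Definition LK_unit : psh_hom F (Res_pi LK_pi) :=
  @PshHom R (transporter rho) F (Res_pi LK_pi) (fun x => @LK_in x) LK_unit_nat.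

(* Universality of the unit, i.e. [LK_pi] is left adjoint to [Res_pi]. *)
Theorem LK_pi_universal (M : presheaf R (group_cat gT))
    (theta : psh_hom F (Res_pi M)) :
  exists psi : psh_hom LK_pi M,
    (forall (x : P) (v : F x), psi tt (LK_unit x v) = theta x v) /\
    (forall psi' : psh_hom LK_pi M,
       (forall (x : P) (v : F x), psi' tt (LK_unit x v) = theta x v) ->
       psi' tt =1 psi tt).
Proof.
have glue (x y : poset_cat P) (f : hom x y) (v : F y) :
    theta x (psh_map F (fmap (tr_incl rho) f) v) = theta y v.
  by rewrite (phom_nat theta) /=; apply: (@psh_map1 R (group_cat gT) M).
pose psi0 : {linear LK_ob -> M tt} := @colim_desc R d P
  (psh_precomp (tr_incl rho) F) (M tt) (fun x => theta x) glue.
have psi0E x (v : F x) : psi0 (LK_in v) = theta x v.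
  exact: (@colim_desc_in R d P (psh_precomp (tr_incl rho) F) (M tt)
    (fun x => theta x) glue x v).
have psi0_nat (x y : group_cat gT) (g : hom x y) (w : LK_ob) :
    psi0 (LK_act g w) = psh_map M (g : @hom (group_cat gT) tt tt) (psi0 w).
  apply: (LK_ext (f := psi0 \o LK_act g)
    (g := psh_map M (g : @hom (group_cat gT) tt tt) \o psi0)) => {w} z v.
  transitivity (psi0 (LK_act g (LK_in v))); first by [].
  rewrite LK_act_E psi0E (phom_nat theta).
  exact: (congr1 (psh_map M (g : @hom (group_cat gT) tt tt)) (esym (psi0E z v))).
pose psi := @PshHom R (group_cat gT) LK_pi M
  (fun x => match x with tt => psi0 end)
  (fun x y => match x, y with tt, tt => @psi0_nat tt tt end).
exists psi; split=> [x v|psi' psi'E]; first exact: psi0E.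
by apply: LK_ext => x v; rewrite [RHS]psi0E -psi'E.
Qed.

End Object.
End LeftKan.

(* Main.v *)
From HB Require Import structures.
From mathcomp Require Import all_boot all_order all_fingroup all_algebra.
From mathcomp Require Import fingraph.
Require Import Defs.

(** For [F = Res_pi M] the colimit computing [LK_pi F] has one class [v]_x for
    each object x and each v in M, and [v]_x depends only on v and on the
    component of x, because the presheaf is constant along P.  So [LK_pi F] is a
    direct sum of copies of M indexed by the components, permuted by the group,
    and the counit eps : LK_pi (Res_pi M) -> M, which sends [v]_x to v, folds these
    copies together.

    Averaging over the components gives a section of eps.  Let n be the number of
    components, u an inverse of n in R, and
      sigma v = u * (sum over the components of the class [v]_x),
    where x is any object of the component ([average]).  The group permutes the
    components, so sigma is equivariant ([average_equivariant]), and
    eps (sigma v) = u * n * v = v ([averageK]).  Hence M is a direct summand of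
    [LK_pi (Res_pi M)], with the kernel of eps as a complement
    ([split_direct_summand]).

    If P is connected, then all the classes [v]_x are equal, so
    sigma (eps [v]_x) = u * n * [v]_x = [v]_x, and eps is an isomorphism
    ([average_connected]).  The computation takes place at a given x, so it covers
    the empty poset as well: there the colimit is zero, and M is zero because 0 is invertible in R. *)

Set Implicit Arguments.
Unset Strict Implicit.
Unset Printing Implicit Defensive.

Import GRing.Theory.

Local Open Scope ring_scope.

(** * Split epimorphisms of presheaves *)

Section Kernel.
Variables (R : pzRingType) (V W : lmodType R) (f : {linear V -> W}).

Definition kernel_pred : pred V := fun v => f v == 0.

Lemma kernel_closed : submod_closed kernel_pred.
Proof.
split; first by rewrite unfold_in linear0.
by move=> a u v /eqP fu /eqP fv; rewrite unfold_in linearP fu fv scaler0 addr0.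
Qed.

HB.instance Definition _ :=
  GRing.isSubmodClosed.Build R V kernel_pred
    (GRing.submod_closed_semi kernel_closed).

Record kernel := Kernel { kernel_val : V; kernel_valP : kernel_val \in kernel_pred }.

HB.instance Definition _ := [isSub for kernel_val].
HB.instance Definition _ := [Choice of kernel by <:].
HB.instance Definition _ := [SubChoice_isSubLmodule of kernel by <:].

Lemma kernelP (k : kernel) : f (val k) = 0.
Proof. exact/eqP/(valP k). Qed.

End Kernel.

Lemma fin_gen_surj (R : pzRingType) (V W : lmodType R) (f : {linear V -> W}) :
  (forall w, exists v, w = f v) -> fin_gen V -> fin_gen W.
Proof.
move=> f_surj [s sV]; exists (map f s) => w; have [v ->] := f_surj w.
by apply: in_span_sub (sV v) _ => u su; apply: map_f.
Qed.

Section Splitting.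
Variables (R : comPzRingType) (C : category) (M H : presheaf R C).
Variables (s : psh_hom M H) (e : psh_hom H M).
Hypothesis sK : forall x, cancel (s x) (e x).

Section KernelMap.
Variables (x y : C) (f : hom x y).

Lemma ker_map_subproof (k : kernel (e y)) : psh_map H f (val k) \in kernel_pred (e x).
Proof. by rewrite unfold_in (phom_nat e) kernelP linear0. Qed.

Definition ker_map (k : kernel (e y)) : kernel (e x) := Kernel (ker_map_subproof k).

Lemma ker_map_linear : linear ker_map.
Proof. by move=> a u v; apply: val_inj; rewrite /= !linearP. Qed.

HB.instance Definition _ :=
  GRing.isLinear.Build R (kernel (e y)) (kernel (e x)) *:%R ker_map ker_map_linear.
End KernelMap.

Section KernelProjection.
Variable x : C.

Lemma ker_proj_subproof (v : H x) : v - s x (e x v) \in kernel_pred (e x).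
Proof. by rewrite unfold_in linearB /= sK subrr. Qed.

Definition ker_proj (v : H x) : kernel (e x) := Kernel (ker_proj_subproof v).

Lemma ker_proj_linear : linear ker_proj.
Proof.
by move=> a u v; apply: val_inj; rewrite /= [e x _]linearP [s x _]linearP scalerBr opprD addrACA.
Qed.

HB.instance Definition _ :=
  GRing.isLinear.Build R (H x) (kernel (e x)) *:%R ker_proj ker_proj_linear.

Lemma ker_projK : cancel (fun k : kernel (e x) => val k) ker_proj.
Proof. by move=> k; apply: val_inj; rewrite /= kernelP linear0 subr0. Qed.

(** A kernel need not be finitely generated over a general ring; this one is a
    quotient of [H x], by the projection along the image of the section. *)
Lemma ker_fg : fin_gen (kernel (e x)).
Proof.
by apply: (fin_gen_surj (f := ker_proj)) (psh_fg H x) => k; exists (val k); rewrite /= ker_projK.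
Qed.
End KernelProjection.

Definition ker_psh : presheaf R C.
Proof.
refine (@Presheaf R C (fun x => kernel (e x) : lmodType R)
  (fun x y f => ker_map f : {linear _ -> _}) _ _ ker_fg).
- by move=> x k; apply: val_inj; rewrite /= psh_map1.
- by move=> x y z f g k; apply: val_inj; rewrite /= psh_mapM.
Defined.

(** With e s = 1, an element v of H splits as s (e v) plus its part in the kernel
    of e. *)
Lemma split_direct_summand : direct_summand M H.
Proof.
exists ker_psh.
pose a0 x (v : H x) : (M x * kernel (e x))%type := (e x v, ker_proj v).
have a0L x : linear (@a0 x).
  by move=> c u v; rewrite /a0 !linearP.
pose b0 x (p : (M x * kernel (e x))%type) : H x := s x p.1 + val p.2.
have b0L x : linear (@b0 x).
  by move=> c p q; rewrite /b0 /= !linearP /= scalerDr addrACA.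
pose a x : {linear H x -> psh_sum M ker_psh x} :=
  HB.pack (@a0 x) (GRing.isLinear.Build R _ _ *:%R (@a0 x) (a0L x)).
pose b x : {linear psh_sum M ker_psh x -> H x} :=
  HB.pack (@b0 x) (GRing.isLinear.Build R _ _ *:%R (@b0 x) (b0L x)).
have a_nat x y (f : hom x y) (v : H y) :
    a x (psh_map H f v) = psh_map (psh_sum M ker_psh) f (a y v).
  congr pair; first exact: phom_nat.
  by apply: val_inj; rewrite /= !phom_nat linearB.
have b_nat x y (f : hom x y) (p : psh_sum M ker_psh y) :
    b x (psh_map (psh_sum M ker_psh) f p) = psh_map H f (b y p).
  by rewrite /= /b0 /= phom_nat linearD.
exists (PshHom a_nat), (PshHom b_nat) => x; split=> [v|[m k]].
  by rewrite /= /b0 /= addrC subrK.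
have em : e x (s x m + val k) = m by rewrite linearD /= sK kernelP addr0.
congr pair; first exact: em.
by apply: val_inj; rewrite /= /b0 /= em [s x m + _]addrC addrK.
Qed.

End Splitting.

(** * Sums over connected components *)

Section SumRoots.
Variables (T : finType) (e : rel T) (V : nmodType) (f : T -> V).
Hypothesis csym : connect_sym e.
Hypothesis fC : forall x y, connect e x y -> f x = f y.

(** A graph automorphism permutes the components, although it need not permute
    their chosen representatives: it has to be followed by [root]. *)
Lemma sum_roots_auto (h h' : T -> T) :
    cancel h h' -> cancel h' h ->
    (forall x y, connect e x y -> connect e (h x) (h y)) ->
    (forall x y, connect e x y -> connect e (h' x) (h' y)) ->
  \sum_(x in roots e) f (h x) = \sum_(x in roots e) f x.
Proof.
move=> hK h'K hC h'C.
rewrite [RHS](reindex_onto (root e \o h) (root e \o h')) /=; last first.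
  move=> x /eqP xr; rewrite -[RHS]xr; apply/(rootP csym).
  by rewrite -[X in connect e _ X]h'K; apply: hC; rewrite csym connect_root.
apply: eq_big => [x | x _]; last exact/fC/connect_root.
rewrite [root e (h x) \in _](roots_root csym) /=.
suff -> : root e (h' (root e (h x))) = root e x by [].
apply/(rootP csym); rewrite -[X in connect e _ X]hK.
by apply: h'C; rewrite csym connect_root.
Qed.

End SumRoots.

Section Comparability.
Variables (d : Order.disp_t) (P : finPOrderType d).

Definition comparability : rel P := fun x y => (x >=< y)%O.

Lemma comparability_sym : connect_sym comparability.
Proof.
by apply: sym_connect_sym => x y; rewrite /comparability Order.POrderTheory.comparable_sym.
Qed.

Lemma card_comparability_roots : #|roots comparability| = Pi0 P.
Proof. by apply: eq_card => x; rewrite !inE andbT. Qed.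

Variables (gT : finGroupType) (rho : poset_action gT P).

Lemma connect_pact g x y :
  connect comparability x y -> connect comparability (rho g x) (rho g y).
Proof.
case/connectP=> p; elim: p x => [|z p IH] x /=; first by move=> _ ->.
case/andP=> xz zp yE; apply: connect_trans (IH z zp yE); apply: connect1.
by move: xz; rewrite /comparability /Order.comparable !pact_mono.
Qed.

Lemma pactK g : cancel (rho g) (rho g^-1%g).
Proof. by move=> x; rewrite -pactM mulVg pact1. Qed.

Lemma pactVK g : cancel (rho g^-1%g) (rho g).
Proof. by move=> x; rewrite -pactM mulgV pact1. Qed.

End Comparability.

(** * The counit and its averaging section *)

Section Averaging.
Variables (R : comPzRingType) (gT : finGroupType) (d : Order.disp_t).
Variables (P : finPOrderType d) (rho : poset_action gT P).
Variable M : presheaf R (group_cat gT).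

Local Notation kM := (Res_pi rho M).
Local Notation cls x v := (@LK_in R gT d P rho kM x v).

(** A morphism of P lies over the neutral element, so it restricts the constant
    presheaf by the identity, and the colimit identifies the two copies of v. *)
Lemma LK_in_connect (x y : P) (v : M tt) :
  connect (@comparability d P) x y -> cls x v = cls y v.
Proof.
move/zigzag_comparable; elim=> {x y} [x y [xy]|x|x y _ ->|x y z _ -> _ ->] //.
pose f := fmap (tr_incl rho) (xy : @hom (poset_cat P) x y).
have fv : psh_map kM f v = v by exact: (@psh_map1 R (group_cat gT) M tt).
have iv : psh_map kM (idm (y : transporter rho)) v = v by exact: psh_map1.
rewrite -[in LHS]fv -[in RHS]iv; exact: LK_in_glue.
Qed.

(** This is the map adjoint to the identity of the constant presheaf; its values on
    the generating classes are all that the splitting uses. *)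
Lemma counit_exists :
  exists eps : psh_hom (LK_pi kM) M, forall (x : P) (v : M tt), eps tt (cls x v) = v.
Proof.
pose theta : psh_hom kM kM :=
  @PshHom R (transporter rho) kM kM (fun x => idfun) (fun x y f v => erefl).
have [eps [epsE _]] := LK_pi_universal theta.
by exists eps => x v; apply: epsE.
Qed.

Variable u : R.

Definition average (v : M tt) : LK_pi kM tt :=
  u *: \sum_(x in roots (@comparability d P)) cls x v.

Lemma average_linear : linear average.
Proof.
move=> a v w; rewrite /average scalerA mulrC -scalerA -scalerDr; congr (_ *: _).
rewrite scaler_sumr -big_split /=; apply: eq_bigr => x _.
exact: (@LK_in_linear R gT d P rho kM x).
Qed.

HB.instance Definition _ :=
  GRing.isLinear.Build R (M tt) (LK_pi kM tt) *:%R average average_linear.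

(** The action moves the class at x to the class at ^(g^-1) x, and the classes of
    a fixed vector form a function of the component, so the sum over the
    components is only reindexed. *)
Lemma average_equivariant (g : gT) (v : M tt) :
  average (psh_map M (g : @hom (group_cat gT) tt tt) v) = LK_act kM g (average v).
Proof.
rewrite /average [RHS]linearZ; congr (_ *: _); rewrite [RHS]linear_sum.
rewrite -(@sum_roots_auto _ _ _ _ _ _ (rho g^-1%g) (rho g)); first last.
- exact: connect_pact.
- exact: connect_pact.
- exact: pactK.
- exact: pactVK.
- by move=> x y; apply: LK_in_connect.
- exact: comparability_sym.
by apply: eq_bigr => x _; rewrite LK_act_E.
Qed.

Definition average_hom : psh_hom M (LK_pi kM) :=
  @PshHom R (group_cat gT) M (LK_pi kM)
    (fun x => match x with tt => average : {linear _ -> _} end)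
    (fun x y => match x, y with tt, tt => average_equivariant end).

Hypothesis uK : u * (Pi0 P)%:R = 1.

(** The counit sends each of the [Pi0 P] summands of the average to v. *)
Lemma averageK (eps : psh_hom (LK_pi kM) M) :
    (forall (x : P) (v : M tt), eps tt (cls x v) = v) ->
  forall x, cancel (average_hom x) (eps x).
Proof.
move=> epsE [] v; rewrite /= /average linearZ linear_sum /=.
rewrite (eq_bigr (fun=> v)) // sumr_const card_comparability_roots.
by rewrite -scaler_nat scalerA uK scale1r.
Qed.

(** When P is connected all the summands of the average are one and the same
    class, and it suffices to compare both sides on the generating classes. *)
Lemma average_connected (eps : psh_hom (LK_pi kM) M) :
    (forall (x : P) (v : M tt), eps tt (cls x v) = v) ->
    connected_cat (poset_cat P) ->
  forall x, cancel (eps x) (average_hom x).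
Proof.
move=> epsE conn [].
apply: (@LK_ext R gT d P rho kM _ (average_hom tt \o eps tt) idfun) => x v.
rewrite /= epsE /average (eq_bigr (fun=> cls x v)); last first.
  by move=> y _; apply/LK_in_connect/zigzag_comparable/conn.
by rewrite sumr_const card_comparability_roots -scaler_nat scalerA uK scale1r.
Qed.

End Averaging.

Unset Implicit Arguments.

Theorem theorem3p1 (R : comPzRingType) (gT : finGroupType)
    (d : Order.disp_t) (P : finPOrderType d) (rho : poset_action gT P)
    (conn : connected_cat (transporter rho))
    (inv : exists u : R, u * (Pi0 P)%:R = 1) :
  (forall M : presheaf R (group_cat gT),
     exists F : presheaf R (transporter rho), direct_summand M (LK_pi F)) /\
  (connected_cat (poset_cat P) ->
     forall M : presheaf R (group_cat gT), psh_iso M (LK_pi (Res_pi rho M))).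
Proof.
have [u uK] := inv; split=> [M | Pconn M];
  have [eps epsE] := counit_exists rho M.
  exists (Res_pi rho M).
  exact: split_direct_summand (averageK uK epsE).
exists (average_hom rho M u), eps => x.
by split; [apply: (averageK uK epsE) | apply: (average_connected uK epsE Pconn)].
Qed.
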